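(* Let $f:\mathbb{R}^n\to\mathbb{R}$ belong to the class $C^1_{L_1}$ and let $f$ be strongly convex with parameter $m>0$, with unique minimizer $x^*$. Consider the random sequence $\{x_k\}_{k\ge 0}$ generated from an arbitrary starting point $x_0\in\mathbb{R}^n$ by Random Pursuit $\mathcal{RP}_\mu$ with absolute line search accuracy $\mu\ge 0$. Then for any integer $N\ge 0$, $$\mathbb{E}\left[f(x_N)-f(x^* )\right]\le\left(1-\frac{m}{L_1 n}\right)^N\left(f(x_0)-f(x^* )\right)+\frac{L_1^2\, n\,\mu^2}{2m}.$$
   Context: Norms are Euclidean and $\langle\cdot,\cdot\rangle$ is the standard inner product on $\mathbb{R}^n$; $S^{n-1}=\{y\in\mathbb{R}^n:\|y\|=1\}$. Class $C^1_{L_1}$ ($L_1>0$): differentiable convex functions $f:\mathbb{R}^n\to\mathbb{R}$ with $f(y)-f(x)-\langle\nabla f(x),y-x\rangle\le\frac{L_1}{2}\|x-y\|^2$ for all $x,y\in\mathbb{R}^n$. Strong convexity with parameter $m>0$: $f(y)-f(x)-\langle\nabla f(x),y-x\rangle\ge\frac{m}{2}\|y-x\|^2$ for all $x,y\in\mathbb{R}^n$. Exact line search oracle: a function $\mathrm{LS}:\mathbb{R}^n\times S^{n-1}\to\mathbb{R}$ with $\mathrm{LS}(x,u)\in\arg\min_{h\in\mathbb{R}}f(x+hu)$ (the argmin need not be unique; LS selects one element). Given such LS, an absolute approximate line search oracle with accuracy $\mu\ge0$ is a function $\mathrm{LSapprox}^{\mathrm{abs}}_\mu:\mathbb{R}^n\times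 S^{n-1}\to\mathbb{R}$ with $\mathrm{LS}(x,u)-\mu\le\mathrm{LSapprox}^{\mathrm{abs}}_\mu(x,u)\le\mathrm{LS}(x,u)+\mu$ for all $x,u$. The oracles are taken to be Borel measurable so that expectations are meaningful. Random Pursuit $\mathcal{RP}_\mu$ with absolute line search accuracy $\mu$: starting from a deterministic $x_0\in\mathbb{R}^n$, at each iteration $k=0,1,2,\dots$ a direction $u_k$ is drawn uniformly at random from $S^{n-1}$, independently of the previous draws, and $x_{k+1}:=x_k+\mathrm{LSapprox}^{\mathrm{abs}}_\mu(x_k,u_k)\,u_k$. *)

(* Defs.v *)
From HB Require Import structures.
From mathcomp Require Import all_boot all_order all_algebra.
From mathcomp Require Import all_classical all_reals all_analysis.

Set Implicit Arguments.
Unset Strict Implicit.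
Unset Printing Implicit Defensive.

Import Order.TTheory GRing.Theory Num.Theory.
Import numFieldNormedType.Exports.

Local Open Scope classical_set_scope.
Local Open Scope ring_scope.

(* R^n with its Borel sigma-algebra. *)
Notation borelRn R n := (g_sigma_algebraType (@open 'rV[R]_n)).

Section Euclidean.
Context {R : realType} {n : nat}.
Implicit Types (x y u v : 'rV[R]_n) (f : 'rV[R]_n -> R).

Definition inner x y : R := \sum_(i < n) x ord0 i * y ord0 i.

(* The library norm `|x| on 'rV[R]_n is the sup norm, hence this one. The
   topology, and so [differentiable] and the Borel sets, are the same. *)
Definition enorm x : R := Num.sqrt (inner x x).

Definition unit_sphere : set 'rV[R]_n := [set u | enorm u = 1].

Definition gradient f x : 'rV[R]_n := \row_i 'D_(delta_mx ord0 i) f x.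

Record class_C1 (L1 : R) f : Prop := {
  class_C1_differentiable : forall x, differentiable f x;
  class_C1_convex : convex_function [set: convex_lmodType 'rV[R]_n] f;
  class_C1_upper : forall x y,
    f y - f x - inner (gradient f x) (y - x) <= L1 / 2 * enorm (x - y) ^+ 2
}.

Definition strongly_convex (m : R) f : Prop := forall x y,
  m / 2 * enorm (y - x) ^+ 2 <= f y - f x - inner (gradient f x) (y - x).

End Euclidean.

Definition argmin {R : realType} {T : Type} (phi : T -> R) : set T :=
  [set t | forall s, phi t <= phi s].

(* Oracles are functions on R^n x S^{n-1}: they are represented by total
   functions on R^n x R^n which are unconstrained when the second argument is
   not a unit vector, and which are only required to be Borel measurable on
   R^n x S^{n-1}. *)
Section Oracles.
Context {R : realType} {n : nat}.
Implicit Types (f : 'rV[R]_n -> R) (O : 'rV[R]_n -> 'rV[R]_n -> R).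

Definition exact_line_search f O : Prop := forall x u,
  unit_sphere u -> argmin (fun h : R => f (x + h *: u)) (O x u).

Definition approx_line_search_abs O (mu : R) (Oa : 'rV[R]_n -> 'rV[R]_n -> R) :
  Prop := forall x u, unit_sphere u -> O x u - mu <= Oa x u <= O x u + mu.

Definition measurable_oracle O : Prop :=
  measurable_fun ([set: borelRn R n] `*` (unit_sphere : set (borelRn R n)))
    (fun p : borelRn R n * borelRn R n => O p.1 p.2).

Fixpoint random_pursuit (Oa : 'rV[R]_n -> 'rV[R]_n -> R) (x0 : 'rV[R]_n)
    (u : nat -> 'rV[R]_n) (k : nat) : 'rV[R]_n :=
  if k is k'.+1 then
    let x := random_pursuit Oa x0 u k' in x + Oa x (u k') *: u k'
  else x0.

(* The uniform distribution on S^{n-1} is the Borel probability measure carried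
   by S^{n-1} and invariant under the orthogonal group O(n). *)
Definition uniform_on_sphere (mu : probability (borelRn R n) R) : Prop :=
  mu (unit_sphere : set (borelRn R n)) = 1%E /\
  forall (Q : 'M[R]_n) (A : set (borelRn R n)),
    Q *m Q^T = 1%:M -> measurable A ->
    mu [set v : borelRn R n | A ((v : 'rV[R]_n) *m Q)] = mu A.

End Oracles.

Definition mutually_independent {d d' : measure_display}
    {T : measurableType d} {T' : measurableType d'} {R : realType}
    {P : probability T R} {I : eqType} (X : I -> {RV P >-> T'}) : Prop :=
  forall (s : seq I) (A : I -> set T'), uniq s ->
    (forall i, measurable (A i)) ->
    P (\bigcap_(i in [set` s]) (X i @^-1` A i)) =
      (\prod_(i <- s) P (X i @^-1` A i))%E.

(* Main.v *)
From HB Require Import structures.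
Require Import Defs.
From mathcomp Require Import all_boot all_order all_algebra.
From mathcomp Require Import all_classical all_reals all_analysis.
From mathcomp Require Import measurable_realfun ring lra.
Import Order.TTheory GRing.Theory Num.Theory.
Import numFieldNormedType.Exports.
Local Open Scope classical_set_scope.
Local Open Scope ring_scope.

(** Write [g] for the gradient at the current iterate [x] and [u] for the
    direction drawn there.

    For a fixed direction, smoothness bounds [f] on the line by a parabola, so
    that exact line search gains at least [<g, u>^2 / (2 L)]. At the exact
    minimum the slope along [u] is zero, hence by smoothness again an error of
    at most [mu] in the step costs at most [L mu^2 / 2]. This is
    [approx_line_search_decrease].

    On average, [E <g, u>^2 = |g|^2 / n] for a fixed [g]: by invariance under
    reflections the left side depends only on the length of [g], and over the
    [n] coordinate directions these means add up to [E |u|^2 = 1]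
    ([uniform_sqr_inner]). The iterate depends only on the earlier directions,
    thus is independent of [u] ([past_independent], a uniqueness-of-measures
    argument), and Tonelli's theorem gives the same identity with the random
    gradient in place of [g] ([iterate_sqr_inner]). Tonelli needs measurability
    of the iterates and of the gradient, and both reduce to coordinates
    ([measurable_of_coord]).

    Strong convexity gives [|g|^2 >= 2 m (f x - f xstar)], so that the expected
    gap [e_k] satisfies [e_(k+1) <= (1 - m / (L n)) e_k + L mu^2 / 2]. The
    additive term of the theorem is the fixed point of this recursion, and
    [m <= L] makes its ratio nonnegative.

    All the integrals are of nonnegative functions, so that no integrability
    has to be known in advance: finiteness of [e_k] comes out of the bound. *)

Set Implicit Arguments.
Unset Strict Implicit.

(** * Euclidean geometry and the gain of one line search *)

Section EuclideanGeometry.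
Context {R : realType} {n : nat}.
Implicit Types (x y z u v : 'rV[R]_n) (f : 'rV[R]_n -> R) (a : R).

Lemma innerC x y : inner x y = inner y x.
Proof. by apply: eq_bigr => i _; rewrite mulrC. Qed.

Lemma innerDl x y z : inner (x + y) z = inner x z + inner y z.
Proof. by rewrite -big_split; apply: eq_bigr => i _; rewrite mxE mulrDl. Qed.

Lemma innerZl a x y : inner (a *: x) y = a * inner x y.
Proof. by rewrite mulr_sumr; apply: eq_bigr => i _; rewrite mxE mulrA. Qed.

Lemma innerNl x y : inner (- x) y = - inner x y.
Proof. by rewrite -scaleN1r innerZl mulN1r. Qed.

Lemma innerDr x y z : inner z (x + y) = inner z x + inner z y.
Proof. by rewrite innerC innerDl !(innerC z). Qed.

Lemma innerZr a x y : inner x (a *: y) = a * inner x y.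
Proof. by rewrite innerC innerZl innerC. Qed.

Lemma innerNr x y : inner x (- y) = - inner x y.
Proof. by rewrite innerC innerNl innerC. Qed.

Lemma inner_ge0 x : 0 <= inner x x.
Proof. by apply: sumr_ge0 => i _; exact: sqr_ge0. Qed.

Lemma enorm_sqr x : enorm x ^+ 2 = inner x x.
Proof. by rewrite sqr_sqrtr ?inner_ge0. Qed.

Lemma inner_sphere u : unit_sphere u -> inner u u = 1.
Proof. by rewrite -enorm_sqr => ->; rewrite expr1n. Qed.

Lemma inner_delta x (i : 'I_n) : inner x (delta_mx ord0 i) = x ord0 i.
Proof.
rewrite /inner (bigD1 i)//= mxE !eqxx mulr1 big1 ?addr0// => j ji.
by rewrite mxE (negbTE ji) andbF mulr0.
Qed.

Lemma inner_mulmx x y : x *m y^T = (inner x y)%:M.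
Proof.
apply/matrixP => i j; rewrite !mxE !ord1/= mulr1n.
by apply: eq_bigr => k _; rewrite mxE.
Qed.

Lemma inner_orthogonal (Q : 'M[R]_n) x y : Q *m Q^T = 1%:M ->
  inner (x *m Q) (y *m Q) = inner x y.
Proof.
move=> QQ; have : (inner (x *m Q) (y *m Q))%:M = (inner x y)%:M :> 'M[R]_1.
  by rewrite -!inner_mulmx trmx_mul mulmxA -(mulmxA x) QQ mulmx1.
by move/matrixP => /(_ ord0 ord0); rewrite !mxE.
Qed.

(** The map is the reflection in the hyperplane orthogonal to [x - y]. *)
Lemma householder x y : inner x x = inner y y ->
  exists2 Q : 'M[R]_n, Q *m Q^T = 1%:M & x *m Q = y.
Proof.
move=> xy; have [w wE] : exists w, w = x - y by exists (x - y).
have [w0|w0] := eqVneq (inner w w) 0.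
  exists 1%:M; first by rewrite trmx1 mulmx1.
  suff w_eq0 : w = 0 by rewrite mulmx1; apply: subr0_eq; rewrite -wE.
  apply/rowP => i; rewrite mxE; apply/eqP; rewrite -[_ == _]orbb -mulf_eq0.
  by apply/eqP; apply: (psumr_eq0P _ w0) => // j _; exact: sqr_ge0.
pose c := 2 / inner w w.
have wwE : c * (c * inner w w) = 2 * c by rewrite /c; field.
have Qsym : (1%:M - c *: (w^T *m w))^T = 1%:M - c *: (w^T *m w) :> 'M[R]_n.
  by rewrite linearB/= trmx1 linearZ/= trmx_mul trmxK.
exists (1%:M - c *: (w^T *m w)).
  rewrite Qsym mulmxBl mul1mx mulmxBr mulmx1 -scalemxAl -scalemxAr.
  rewrite mulmxA -(mulmxA w^T w) inner_mulmx mul_mx_scalar -!scalemxAl !scalerA.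
  rewrite wwE mulr2n mulrDl mul1r scalerDl.
  by rewrite opprB addrK subrK.
rewrite mulmxBr mulmx1 -scalemxAr mulmxA inner_mulmx mul_scalar_mx scalerA.
suff -> : c * inner x w = 1 by rewrite scale1r wE opprB addrC subrK.
have xwE : 2 * inner x w = inner w w.
  rewrite wE !innerDr !innerDl !innerNr !innerNl (innerC y x) -xy; ring.
by rewrite /c mulrAC xwE mulfV.
Qed.

(** If the slope [a] at the minimum on the line were not zero, then by the
    quadratic upper bound the step [- (a / L)] from there would lower [f]. *)
Lemma exact_line_search_orthogonal (L h : R) f x u : 0 < L -> class_C1 L f ->
  inner u u = 1 -> argmin (fun t : R => f (x + t *: u)) h ->
  inner (gradient f (x + h *: u)) u = 0.
Proof.
move=> L0 fC uu hmin; set y := x + h *: u; set a := inner _ _.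
have := class_C1_upper fC y (y - (a / L) *: u).
have -> : y - (a / L) *: u - y = - ((a / L) *: u) by rewrite addrAC subrr sub0r.
rewrite enorm_sqr opprB addrCA subrr addr0.
rewrite innerNr !innerZr innerZl uu -/a.
have := hmin (h - a / L); rewrite scalerBl addrA -/y => le1 le2.
have : (a / L) * a <= L / 2 * (a / L * (a / L * 1)) by move: le1 le2; lra.
have -> : L / 2 * (a / L * (a / L * 1)) = a ^+ 2 / L / 2.
  by field; rewrite gt_eqF.
have -> : (a / L) * a = a ^+ 2 / L by rewrite mulrAC.
have : 0 <= a ^+ 2 / L by rewrite divr_ge0 ?sqr_ge0 ?ltW.
move=> p q; have /eqP : a ^+ 2 / L = 0 by move: p q; lra.
by rewrite mulf_eq0 invr_eq0 (gt_eqF L0) orbF sqrf_eq0 => /eqP.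
Qed.

(** The gain of the exact search is the gain at the minimum of the quadratic
    model; the loss is quadratic in the error because the slope vanishes at
    the exact minimum. *)
Lemma approx_line_search_decrease (L mu h h' : R) f x u : 0 < L ->
  class_C1 L f -> inner u u = 1 ->
  argmin (fun t : R => f (x + t *: u)) h -> h - mu <= h' <= h + mu ->
  f (x + h' *: u) + (inner (gradient f x) u) ^+ 2 / (2 * L)
    <= f x + L * mu ^+ 2 / 2.
Proof.
move=> L0 fC uu hmin hh'.
have orth := exact_line_search_orthogonal L0 fC uu hmin.
have overshoot : f (x + h' *: u) <= f (x + h *: u) + L * mu ^+ 2 / 2.
  have := class_C1_upper fC (x + h *: u) (x + h' *: u).
  have -> : x + h' *: u - (x + h *: u) = (h' - h) *: u.
    by rewrite opprD addrACA subrr add0r -scalerBl.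
  have -> : x + h *: u - (x + h' *: u) = (h - h') *: u.
    by rewrite opprD addrACA subrr add0r -scalerBl.
  rewrite innerZr orth enorm_sqr innerZr innerZl uu.
  have : L * (h - h') ^+ 2 <= L * mu ^+ 2.
    rewrite ler_pM2l// -subr_ge0 subr_sqr.
    by case/andP: hh' => lo hi; rewrite mulr_ge0//; move: lo hi; lra.
  lra.
have decrease : f (x + h *: u) + (inner (gradient f x) u) ^+ 2 / (2 * L) <= f x.
  set a := inner _ _.
  (* [- (a / L)] minimises the quadratic model along the line *)
  have := hmin (- (a / L)).
  have := class_C1_upper fC x (x - (a / L) *: u).
  have -> : x - (a / L) *: u - x = - ((a / L) *: u) by rewrite addrAC subrr sub0r.
  rewrite enorm_sqr opprB addrCA subrr addr0.
  rewrite innerNr !innerZr innerZl uu -/a scaleNr.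
  have -> : L / 2 * (a / L * (a / L * 1)) = a ^+ 2 / (2 * L).
    by field; rewrite gt_eqF.
  have -> : (a / L) * a = 2 * (a ^+ 2 / (2 * L)) by field; rewrite gt_eqF.
  lra.
lra.
Qed.

(** Completing the square in the quadratic lower bound at [y]. *)
Lemma strongly_convex_gradient_ge (m : R) f x y : 0 < m -> strongly_convex m f ->
  2 * m * (f x - f y) <= inner (gradient f x) (gradient f x).
Proof.
move=> m0 /(_ x y); rewrite enorm_sqr; set g := gradient f x; set v := y - x => lb.
have := inner_ge0 (g + m *: v).
rewrite !innerDl !innerDr !innerZl !innerZr (innerC v g) => sq.
have : 2 * m * (m / 2 * inner v v) <= 2 * m * (f y - f x - inner g v).
  by rewrite ler_pM2l ?mulr_gt0.
by move: sq; lra.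
Qed.

(** Any pair of distinct points compares the two quadratic bounds; a unit
    coordinate vector exists since [n] is positive. *)
Lemma strongly_convex_le_smooth (L m : R) f : (0 < n)%N -> class_C1 L f ->
  strongly_convex m f -> m <= L.
Proof.
move=> n0 fC /(_ 0 (delta_mx ord0 (Ordinal n0))) lb.
have := le_trans lb (class_C1_upper fC _ _).
rewrite subr0 sub0r !enorm_sqr innerNl innerNr opprK inner_delta mxE !eqxx !mulr1; lra.
Qed.

End EuclideanGeometry.

(** * Borel measurability in R^n *)

Lemma bigcup_countType_measurable d (T : sigmaRingType d) (I : countType)
    (D : set I) (F : I -> set T) :
  (forall i, D i -> measurable (F i)) -> measurable (\bigcup_(i in D) F i).
Proof.
move=> mF; pose G k := if unpickle k is Some i then
  (if i \in D then F i else set0) else set0.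
rewrite (_ : \bigcup_(i in D) F i = \bigcup_k G k).
  apply: bigcupT_measurable => k; rewrite /G; case: unpickle => // i.
  by case: ifPn => // /[!inE]; exact: mF.
apply/seteqP; split=> [t [i Di Fit]|t [k _]].
  by exists (pickle i) => //; rewrite /G pickleK mem_set.
rewrite /G; case: unpickle => // i; case: ifPn => // /[!inE] Di Fit.
by exists i.
Qed.

Section BorelRn.
Context {R : realType} {n : nat}.

(** [ball] is for the sup norm. *)
Let cube (q : 'rV[rat]_n * nat) : set 'rV[R]_n :=
  ball (map_mx (ratr : rat -> R) q.1 : 'rV[R]_n) q.2.+1%:R^-1.

Lemma measurable_continuous_Rn (f : 'rV[R]_n -> R) : continuous f ->
  measurable_fun [set: borelRn R n] (f : borelRn R n -> R).
Proof.
move=> /continuousP cf; apply: (measurability _ (RGenOpens.measurableE R)).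
move=> _ [_ [a [b ->] <-]]; rewrite setTI; apply: sub_sigma_algebra.
exact/cf/interval_open.
Qed.

Lemma measurable_coord (i : 'I_n) :
  measurable_fun [set: borelRn R n] (fun x : borelRn R n => (x : 'rV[R]_n) ord0 i).
Proof. exact: measurable_continuous_Rn (@coord_continuous R 1 n ord0 i). Qed.

Lemma open_rat_cubes (U : set 'rV[R]_n) : open U ->
  U = \bigcup_(q in [set q | cube q `<=` U]) cube q.
Proof.
move=> oU; apply/seteqP; split=> [x Ux|x [q]]; last exact.
have /nbhs_ballP[e /= e0 xeU] : nbhs x U by exact: open_nbhs_nbhs.
have [k ke] : exists k : nat, k.+1%:R^-1 < e / 2.
  by have [k] := ltr_add_invr (divr_gt0 e0 (@ltr0Sn R 1)); rewrite add0r; exists k.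
have /choice[q hq] (i : 'I_n) : exists q : rat, ball (x ord0 i) k.+1%:R^-1 (ratr q : R).
  have : x ord0 i < x ord0 i + k.+1%:R^-1 by rewrite ltrDl.
  case/rat_in_itvoo => q; rewrite in_itv/= => /andP[q1 q2]; exists q.
  by rewrite /ball/= distrC ltr_distl q2 andbT (lt_trans _ q1)// gtrBl.
have xq : cube (\row_i q i, k) x.
  split; first by rewrite invr_gt0.
  by move=> i j; rewrite !mxE (ord1 i); apply: ball_sym; exact: hq.
exists (\row_i q i, k) => //= y qy; apply: xeU.
apply: (@le_ball _ _ _ (k.+1%:R^-1 + k.+1%:R^-1)).
  by rewrite [leRHS]splitr lerD// ltW.
by apply: ball_triangle qy; exact: ball_sym.
Qed.

(** The Borel sets of [R^n] are generated by the coordinates, since every open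
    set is a countable union of cubes. *)
Lemma measurable_of_coord d (T : measurableType d) (g : T -> borelRn R n) :
  (forall i, measurable_fun setT (fun t => (g t : 'rV[R]_n) ord0 i)) ->
  measurable_fun setT g.
Proof.
move=> mg; apply: (@measurability _ _ T (borelRn R n) setT g open) => // _ [U oU <-].
rewrite setTI (open_rat_cubes oU) preimage_bigcup.
apply: bigcup_countType_measurable => -[q k] _ /=.
rewrite (_ : _ @^-1` _ = \bigcap_(i in [set: 'I_n])
    (fun t => (g t : 'rV[R]_n) ord0 i) @^-1` ball (ratr (q ord0 i) : R) k.+1%:R^-1).
  apply: fin_bigcap_measurable => // i _; rewrite -[X in measurable X]setTI.
  by apply: mg => //; exact: measurable_ball.
apply/seteqP; split=> [t [_ /= gt] i _|t gt].
  by have := gt ord0 i; rewrite mxE.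
split; first by rewrite invr_gt0.
by move=> i j; rewrite mxE (ord1 i); exact: gt.
Qed.

Lemma measurable_inner d (T : measurableType d) (g h : T -> borelRn R n) :
  measurable_fun setT g -> measurable_fun setT h ->
  measurable_fun setT (fun t => inner (g t : 'rV[R]_n) (h t)).
Proof.
move=> mg mh; apply: measurable_sum => i; apply: measurable_funM.
  exact: measurableT_comp (measurable_coord i) mg.
exact: measurableT_comp (measurable_coord i) mh.
Qed.

Lemma measurable_mulmxr (Q : 'M[R]_n) :
  measurable_fun [set: borelRn R n]
    (fun v : borelRn R n => ((v : 'rV[R]_n) *m Q) : borelRn R n).
Proof.
apply: measurable_of_coord => i.
under eq_fun do rewrite mxE.
apply: measurable_sum => j; apply: measurable_funM => //.
exact: measurable_coord.
Qed.

Lemma measurable_unit_sphere :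
  measurable (unit_sphere : set (borelRn R n)).
Proof.
rewrite (_ : unit_sphere =
    (fun x : borelRn R n => inner (x : 'rV[R]_n) x) @^-1` [set 1]).
  rewrite -[X in measurable X]setTI; apply: measurable_inner => //.
apply/seteqP; split=> x; first exact: inner_sphere.
by rewrite /= /unit_sphere /= /enorm => ->; rewrite sqrtr1.
Qed.

(** Each partial derivative is a pointwise limit of the continuous difference
    quotients along the steps [1 / (k + 1)]. *)
Lemma measurable_gradient (f : 'rV[R]_n -> R) : (forall x, differentiable f x) ->
  measurable_fun [set: borelRn R n]
    (fun x : borelRn R n => gradient f x : borelRn R n).
Proof.
move=> df; apply: measurable_of_coord => i; under eq_fun do rewrite mxE.
set e := delta_mx ord0 i.
pose h k (x : borelRn R n) : R := k.+1%:R * (f (k.+1%:R^-1 *: e + (x : 'rV[R]_n)) - f x).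
apply: (@measurable_fun_cvg _ _ _ _ h) => [k|x _].
  have cf : continuous f by move=> x; exact: differentiable_continuous.
  apply: measurable_funM => //.
  apply: measurable_funB; apply: measurable_continuous_Rn => // x.
  apply: (@continuous_comp _ _ _ (fun x => k.+1%:R^-1 *: e + x)); last exact: cf.
  by apply: (@continuousD _ _ _ (cst _) id);
    [exact: cst_continuous|move=> ?; exact: cvg_id].
have dfe := @diff_derivable _ _ _ _ _ e (df x).
have /cvgr_dnbhsP dq := dfe.
have -> : h^~ x = fun k => (harmonic k)^-1 *:
    (((f \o shift (x : 'rV[R]_n)) (harmonic k *: e) : R) - f x).
  by apply/funext => k; rewrite /h /harmonic/= invrK.
apply: dq; split; last exact: cvg_harmonic.
by move=> k; rewrite gt_eqF ?harmonic_gt0.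
Qed.

End BorelRn.

(** * Second moment of the uniform distribution on the sphere *)

Lemma integral_prob_cst {d} {T : measurableType d} {R : realType}
  (P : probability T R) (r : R) : (\int[P]_w r%:E = r%:E)%E.
Proof.
rewrite integral_cst// -[RHS]mule1; congr (_ * _)%E; exact: probability_setT.
Qed.

Section SphereSecondMoment.
Context {R : realType} {n : nat}.
Variable mu : probability (borelRn R n) R.
Hypothesis mu_unif : uniform_on_sphere mu.
Implicit Types g h : 'rV[R]_n.

Let sqr_inner g (v : borelRn R n) : \bar R := ((inner g (v : 'rV[R]_n)) ^+ 2)%:E.

Let measurable_sqr_inner g : measurable_fun setT (sqr_inner g).
Proof.
apply/measurable_EFinP; apply: measurable_funX.
by apply: measurable_inner.
Qed.

(** A reflection that carries [g] to [h] leaves the distribution unchanged. *)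
Lemma uniform_sqr_inner_norm g h : inner g g = inner h h ->
  (\int[mu]_v sqr_inner g v = \int[mu]_v sqr_inner h v)%E.
Proof.
move=> /householder[Q QQ gQ].
pose rot (v : borelRn R n) : borelRn R n := (v : 'rV[R]_n) *m Q.
have mrot : measurable_fun setT rot by exact: measurable_mulmxr.
transitivity (\int[pushforward mu rot]_v sqr_inner h v)%E.
  rewrite ge0_integral_pushforward//; last by move=> v _; rewrite lee_fin sqr_ge0.
  rewrite preimage_setT; apply: eq_integral => v _ /=.
  by rewrite /sqr_inner -gQ /rot inner_orthogonal.
apply: eq_measure_integral => A mA _.
exact: (mu_unif.2 Q A QQ mA).
Qed.

(** The [n] coordinate directions have equal second moments, and these sum to
    one because the distribution is carried by the unit sphere. *)
Lemma uniform_sqr_inner g : (0 < n)%N ->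
  (\int[mu]_v sqr_inner g v = (inner g g / n%:R)%:E)%E.
Proof.
move=> n0; have nR0 : n%:R != 0 :> R by rewrite pnatr_eq0 -lt0n.
set c := inner g g.
pose e (i : 'I_n) : 'rV[R]_n := Num.sqrt c *: delta_mx ord0 i.
have ce i : c = inner (e i) (e i).
  rewrite innerZl innerZr inner_delta mxE !eqxx mulr1 -expr2 sqr_sqrtr//.
  exact: inner_ge0.
have sumE : (\sum_(i < n) \int[mu]_v sqr_inner (e i) v = c%:E)%E.
  rewrite -ge0_integral_sum//; last by move=> i v _; rewrite lee_fin sqr_ge0.
  have S1 : mu (~` (unit_sphere : set (borelRn R n))) = 0%E.
    by rewrite probability_setC ?(proj1 mu_unif) ?subee//; exact: measurable_unit_sphere.
  transitivity (\int[mu]_v cst c%:E v)%E; last first.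
    exact: integral_prob_cst.
  apply: ge0_ae_eq_integral => //.
  - by apply: emeasurable_sum.
  - by move=> v _; apply: sume_ge0 => i _; rewrite lee_fin sqr_ge0.
  - by move=> v _; rewrite lee_fin inner_ge0.
  exists (~` (unit_sphere : set (borelRn R n))); split => //.
    by apply: measurableC; exact: measurable_unit_sphere.
  apply: subsetC => v Sv _ /=; rewrite sumEFin; congr EFin.
  rewrite -[RHS]mulr1 -(inner_sphere Sv) [in RHS]/inner mulr_sumr.
  apply: eq_bigr => i _; rewrite innerZl innerC inner_delta.
  by rewrite exprMn sqr_sqrtr ?inner_ge0.
have nE : (n%:R%:E * \int[mu]_v sqr_inner g v = c%:E)%E.
  rewrite -sumE -(eq_bigr _ (fun i _ => uniform_sqr_inner_norm (ce i))).
  by rewrite sumr_const card_ord mule_natl.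
by rewrite mulrC EFinM -nE muleA -EFinM mulVf// mul1e.
Qed.

End SphereSecondMoment.

(** * Independence of the past *)

Section Independence.
Context {d d1 d2 : measure_display} {T : measurableType d}
  {T1 : measurableType d1} {T2 : measurableType d2} {R : realType}.
Variable P : probability T R.

(** Independence of two random elements says that their joint distribution is a
    product, so Tonelli's theorem integrates out the second one first. *)
Lemma independent_ge0_integral (X : {RV P >-> T1}) (Y : {RV P >-> T2})
    (phi : T1 * T2 -> \bar R) :
  (forall A B, measurable A -> measurable B ->
    (P (X @^-1` A `&` Y @^-1` B) = P (X @^-1` A) * P (Y @^-1` B))%E) ->
  measurable_fun setT phi -> (forall z, 0 <= phi z)%E ->
  (\int[P]_w phi (X w, Y w) =
   \int[P]_w \int[distribution P Y]_y phi (X w, y))%E.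
Proof.
move=> XY mphi phi0.
have mXY : measurable_fun setT (fun w => (X w, Y w)).
  by apply: measurable_fun_pair.
transitivity (\int[pushforward P (fun w => (X w, Y w))]_z phi z)%E.
  by rewrite ge0_integral_pushforward.
transitivity (\int[(distribution P X \x distribution P Y)%E]_z phi z)%E.
  apply: eq_measure_integral => A mA _; apply/esym.
  exact: product_measure_unique.
rewrite fubini_tonelli1// ge0_integral_distribution//.
  exact: measurable_fun_fubini_tonelli_F.
by move=> x; exact: integral_ge0.
Qed.

End Independence.

Section Past.
Context {d d' : measure_display} {T : measurableType d} {T' : measurableType d'}
  {R : realType} {P : probability T R}.
Variable u : nat -> {RV P >-> T'}.

(** A generating class of the sigma-algebra of [u 0], ..., [u (k - 1)] that is
    stable under intersection, on which independence is a direct instance of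
    the product rule. *)
Definition past_cylinders (k : nat) : set (set T) :=
  [set A | exists2 B : nat -> set T', (forall i, measurable (B i)) &
    A = \bigcap_(i in [set` iota 0 k]) (u i @^-1` B i)].

Lemma past_cylinders_measurable k : past_cylinders k `<=` measurable.
Proof.
move=> _ [B mB ->]; apply: fin_bigcap_measurable => [|i _]; first exact: finite_seq.
by rewrite -[X in measurable X]setTI; exact: measurable_funP.
Qed.

Lemma past_cylinders_setI k : setI_closed (past_cylinders k).
Proof.
move=> _ _ [A mA ->] [B mB ->]; exists (fun i => A i `&` B i).
  by move=> i; exact: measurableI.
by rewrite -bigcapI.
Qed.

Lemma past_cylinders_setT k : past_cylinders k setT.
Proof.
by exists (fun=> setT) => //; apply/esym; rewrite -subTset => t _ i _.
Qed.

Lemma past_measurable k (A : set T) : <<s past_cylinders k >> A -> measurable A.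
Proof.
apply: smallest_sub; first exact: sigma_algebra_measurable.
exact: past_cylinders_measurable.
Qed.

Lemma measurable_past i k : (i < k)%N ->
  measurable_fun (setT : set (g_sigma_algebraType (past_cylinders k))) (u i).
Proof.
move=> ik _ B mB; rewrite setTI; apply: sub_sigma_algebra.
exists (fun j => if j == i then B else setT); first by move=> j; case: ifP.
apply/seteqP; split=> [t uB j /= _|t /(_ i)/=].
  by case: ifPn => // /eqP ->.
by rewrite mem_iota ik eqxx; exact.
Qed.

(** The events that factor against an event of [u k] include the cylinders,
    which are stable under intersection; hence they include all events of the
    past. *)
Lemma past_independent k (A : set T) (C : set T') : mutually_independent u ->
  <<s past_cylinders k >> A -> measurable C ->
  (P (A `&` u k @^-1` C) = P A * P (u k @^-1` C))%E.
Proof.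
move=> u_indep pA mC.
have mE : measurable (u k @^-1` C).
  by rewrite -[X in measurable X]setTI; exact: measurable_funP.
set E := u k @^-1` C in mE *.
have PE0 : 0 <= fine (P E) by rewrite fine_ge0.
have PEfin : P E \is a fin_num by exact: fin_num_measure.
transitivity (mscale (NngNum PE0) P A); last first.
  by rewrite /mscale/= fineK// muleC.
rewrite -/(mrestr P mE A).
apply: (g_sigma_algebra_measure_unique (past_cylinders k) _ (fun=> setT)) => //.
- exact: past_cylinders_measurable.
- by move=> _; exact: past_cylinders_setT.
- by rewrite bigcup_const//; exists 0%N.
- exact: past_cylinders_setI.
- move=> _ [B mB ->]; set A' := \bigcap_(i in _) _.
  transitivity (P E * P A')%E; last by congr (_ * _)%E; exact/esym/fineK.
  rewrite [LHS]/(P (A' `&` E)) /A'.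
  pose B' i := if i == k then C else B i.
  have mB' i : measurable (B' i) by rewrite /B'; case: ifP.
  have B'E i : i \in iota 0 k -> B' i = B i.
    by rewrite mem_iota add0n /B' => /andP[_]; case: eqP => // ->; rewrite ltnn.
  have kP : k \notin iota 0 k by rewrite mem_iota ltnn andbF.
  have := u_indep (k :: iota 0 k) B' _ mB'; rewrite /= kP iota_uniq => /(_ isT).
  rewrite big_cons (eq_big_seq (fun i => P (u i @^-1` B i))); last first.
    by move=> i /B'E ->.
  rewrite -(u_indep (iota 0 k) B (iota_uniq _ _) mB) {2}/B' eqxx => <-.
  congr (P _); apply/seteqP; split=> [t [past Et] i /=|t tB'].
    rewrite inE => /orP[/eqP ->|ik]; first by rewrite /B' eqxx.
    by rewrite B'E//; exact: past.
  split=> [i /= ik|]; first by rewrite -B'E//; apply: tB'; rewrite /= inE ik orbT.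
  by have := tB' k; rewrite /= inE eqxx /B' => /(_ isT); rewrite eqxx.
- by move=> _; rewrite [X in (X < _)%E]/(P (setT `&` E)) setTI ltey_eq PEfin.
Qed.

End Past.

(** * The iterates of random pursuit *)

Section RandomPursuit.
Context {R : realType} {n : nat}.
Variables (Oa : 'rV[R]_n -> 'rV[R]_n -> R) (x0 : 'rV[R]_n).
Hypothesis Oa_meas : measurable_oracle Oa.
Context {d : measure_display} {T : measurableType d} {P : probability T R}.
Variable u : nat -> {RV P >-> borelRn R n}.
Hypothesis u_sphere : forall k w, unit_sphere (u k w : 'rV[R]_n).

Definition iterate (k : nat) (w : T) : borelRn R n :=
  random_pursuit Oa x0 (fun j => u j w) k.

(** The induction runs inside the fixed sigma-algebra of the first [k]
    directions, for all [j <= k], which avoids comparing sigma-algebras. The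
    oracle may be composed because the directions stay on the sphere. *)
Lemma iterate_measurable_past k : measurable_fun
  (setT : set (g_sigma_algebraType (past_cylinders u k))) (iterate k).
Proof.
suff H j : (j <= k)%N -> measurable_fun
    (setT : set (g_sigma_algebraType (past_cylinders u k))) (iterate j) by exact: H.
elim: j => [_|j IH jk]; first exact: measurable_cst.
have mx := IH (ltnW jk); have mu := @measurable_past _ _ _ _ _ _ u _ _ jk.
have moracle : measurable_fun
    (setT : set (g_sigma_algebraType (past_cylinders u k)))
    (fun w => Oa (iterate j w) (u j w)).
  have mxu : measurable_fun (setT : set (g_sigma_algebraType (past_cylinders u k)))
    (fun w => (iterate j w, u j w) : borelRn R n * borelRn R n).
    exact: measurable_fun_pair.
  have := @measurable_comp _ _ _ _ _ _ _ _ _ _ _ _ Oa_meas mxu.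
  apply.
  - by apply: measurableX => //; exact: measurable_unit_sphere.
  - by move=> _ [w _ <-]; split => //; exact: u_sphere.
apply: measurable_of_coord => i.
rewrite (_ : (fun w => _) = (fun w => (iterate j w : 'rV[R]_n) ord0 i
  + Oa (iterate j w) (u j w) * (u j w : 'rV[R]_n) ord0 i)); last first.
  by apply/funext => w; rewrite [iterate _ _]/= !mxE.
apply: measurable_funD; first exact: measurableT_comp (measurable_coord i) mx.
apply: measurable_funM => //.
exact: measurableT_comp (measurable_coord i) mu.
Qed.

Lemma iterate_measurable k : measurable_fun [set: T] (iterate k).
Proof.
move=> _ A mA; rewrite setTI; apply: (@past_measurable _ _ _ _ _ _ u k).
by rewrite -[X in <<s _ >> X]setTI; exact: iterate_measurable_past.
Qed.

Hypothesis u_indep : mutually_independent u.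

Lemma iterate_independent k (A B : set (borelRn R n)) :
  measurable A -> measurable B ->
  (P (iterate k @^-1` A `&` u k @^-1` B)
   = P (iterate k @^-1` A) * P (u k @^-1` B))%E.
Proof.
move=> mA mB; apply: past_independent => //.
by rewrite -[X in <<s _ >> X]setTI; exact: iterate_measurable_past.
Qed.

Hypothesis u_unif : forall k, uniform_on_sphere (distribution P (u k)).
Hypothesis n_gt0 : (0 < n)%N.

(** Given the past, [g] is a constant vector and the next direction is still
    uniform. *)
Lemma iterate_sqr_inner k (g : borelRn R n -> borelRn R n) :
  measurable_fun setT g ->
  (\int[P]_w ((inner (g (iterate k w)) (u k w)) ^+ 2)%:E
   = \int[P]_w (inner (g (iterate k w)) (g (iterate k w)) / n%:R)%:E)%E.
Proof.
move=> mg.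
pose X : {RV P >-> borelRn R n} :=
  HB.pack (iterate k) (isMeasurableFun.Build _ _ _ _ _ (iterate_measurable k)).
pose phi (z : borelRn R n * borelRn R n) : \bar R :=
  ((inner (g z.1 : 'rV[R]_n) z.2) ^+ 2)%:E.
have mphi : measurable_fun setT phi.
  apply/measurable_EFinP; apply: measurable_funX; apply: measurable_inner.
    exact: measurableT_comp mg measurable_fst.
  exact: measurable_snd.
transitivity (\int[P]_w phi (X w, u k w))%E; first by [].
rewrite independent_ge0_integral//.
- apply: eq_integral => w _.
  exact: (uniform_sqr_inner (u_unif k) (g (iterate k w)) n_gt0).
- exact: iterate_independent.
- by move=> z; rewrite lee_fin sqr_ge0.
Qed.

End RandomPursuit.

(** * Recursion for the expected gap *)

Section ExpectedProgress.
Context {R : realType} {n : nat}.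
Variables (f : 'rV[R]_n -> R) (L m mu : R) (xstar : 'rV[R]_n).
Hypotheses (n_gt0 : (0 < n)%N) (L_gt0 : 0 < L) (m_gt0 : 0 < m).
Hypotheses (f_C1 : class_C1 L f) (f_sc : strongly_convex m f).
Hypothesis xstar_min : forall x, f xstar <= f x.
Variables LS Oa : 'rV[R]_n -> 'rV[R]_n -> R.
Hypotheses (LS_exact : exact_line_search f LS)
  (Oa_approx : approx_line_search_abs LS mu Oa) (Oa_meas : measurable_oracle Oa).
Context {d : measure_display} {T : measurableType d} {P : probability T R}.
Variable u : nat -> {RV P >-> borelRn R n}.
Hypotheses (u_sphere : forall k w, unit_sphere (u k w : 'rV[R]_n))
  (u_unif : forall k, uniform_on_sphere (distribution P (u k)))
  (u_indep : mutually_independent u).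
Variable x0 : 'rV[R]_n.

Let x_ := iterate Oa x0 u.
Let gap k w : R := f (x_ k w) - f xstar.
Let grad k w : 'rV[R]_n := gradient f (x_ k w).

Let gap_ge0 k w : 0 <= gap k w. Proof. by rewrite subr_ge0. Qed.

Let measurable_gap k : measurable_fun setT (fun w => (gap k w)%:E).
Proof.
apply/measurable_EFinP; apply: measurable_funB => //.
apply: measurableT_comp (iterate_measurable x0 Oa_meas u_sphere k).
apply: measurable_continuous_Rn => x.
exact/differentiable_continuous/(class_C1_differentiable f_C1).
Qed.

Let measurable_grad k : measurable_fun setT (grad k : T -> borelRn R n).
Proof.
exact: measurableT_comp (measurable_gradient (class_C1_differentiable f_C1))
  (iterate_measurable x0 Oa_meas u_sphere k).
Qed.

Lemma gap_step k w :
  gap k.+1 w + (2 * L)^-1 * inner (grad k w) (u k w) ^+ 2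
    <= gap k w + L * mu ^+ 2 / 2.
Proof.
have usph := u_sphere k w.
have hmin := LS_exact (x_ k w) usph.
have herr := Oa_approx (x_ k w) usph.
have := approx_line_search_decrease L_gt0 f_C1 (inner_sphere usph) hmin herr.
rewrite /gap /grad [x_ k.+1 w]/= -/(x_ k w) (mulrC (2 * L)^-1); lra.
Qed.

(** The expectation of [gap_step], stated additively so that it makes sense
    before the expectations are known to be finite. *)
Lemma expected_gap_step k :
  (\int[P]_w (gap k.+1 w)%:E + (m / (L * n%:R))%:E * \int[P]_w (gap k w)%:E
   <= \int[P]_w (gap k w)%:E + (L * mu ^+ 2 / 2)%:E)%E.
Proof.
have nR0 : 0 < n%:R :> R by rewrite ltr0n.
have mgu : measurable_fun setT (fun w => (inner (grad k w) (u k w) ^+ 2)%:E).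
  by apply/measurable_EFinP; apply: measurable_funX; exact: measurable_inner.
have mgg : measurable_fun setT
    (fun w => (inner (grad k w) (grad k w) / n%:R)%:E).
  apply/measurable_EFinP; apply: measurable_funM => //.
  exact: measurable_inner.
have L2 : 0 <= (2 * L)^-1 by rewrite invr_ge0 mulr_ge0// ltW.
have a0 : 0 <= m / (L * n%:R) by rewrite divr_ge0 ?mulr_ge0 ?ltW.
have c0 : 0 <= L * mu ^+ 2 / 2 by rewrite divr_ge0// mulr_ge0 ?sqr_ge0// ltW.
have rhsE : (\int[P]_w (gap k w + L * mu ^+ 2 / 2)%:E =
    \int[P]_w (gap k w)%:E + (L * mu ^+ 2 / 2)%:E)%E.
  under eq_integral do rewrite EFinD.
  rewrite ge0_integralD//; try by move=> w _; rewrite lee_fin.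
  by congr (_ + _)%E; exact: integral_prob_cst.
rewrite -rhsE.
apply: (@le_trans _ _ (\int[P]_w
    (gap k.+1 w + (2 * L)^-1 * inner (grad k w) (u k w) ^+ 2)%:E)%E); last first.
  apply: ge0_le_integral => //.
  - by move=> w _; rewrite lee_fin addr_ge0// mulr_ge0// sqr_ge0.
  - exact: (emeasurable_funD (measurable_gap k.+1) (measurable_funeM (2 * L)^-1%:E mgu)).
  - exact: emeasurable_funD (measurable_gap k) (measurable_cst (L * mu ^+ 2 / 2)%:E).
  - by move=> w _; rewrite lee_fin gap_step.
under [leRHS]eq_integral do rewrite EFinD EFinM.
rewrite ge0_integralD//; first last.
- exact: measurable_funeM.
- by move=> w _; rewrite -EFinM lee_fin mulr_ge0// sqr_ge0.
- by move=> w _; rewrite lee_fin.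
rewrite ge0_integralZl_EFin//; last by move=> w _; rewrite lee_fin sqr_ge0.
rewrite (iterate_sqr_inner x0 Oa_meas u_sphere u_indep u_unif n_gt0 k
  (measurable_gradient (class_C1_differentiable f_C1))).
apply: leeD => //.
rewrite -!ge0_integralZl_EFin//; first last.
- by move=> w _; rewrite lee_fin.
- by move=> w _; rewrite lee_fin divr_ge0 ?inner_ge0 ?ltW.
apply: ge0_le_integral => //.
- by move=> w _; rewrite -EFinM lee_fin mulr_ge0.
- exact: measurable_funeM.
- exact: measurable_funeM.
move=> w _; rewrite -!EFinM lee_fin.
have := strongly_convex_gradient_ge (x_ k w) xstar m_gt0 f_sc.
rewrite -/(gap k w) -/(grad k w) => ggE.
have -> : m / (L * n%:R) * gap k w = (2 * L)^-1 * (2 * m * gap k w / n%:R).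
  by field; rewrite !gt_eqF.
by rewrite ler_wpM2l// ler_wpM2r// invr_ge0 ltW.
Qed.

Lemma expected_gap_le N : (\int[P]_w (gap N w)%:E <=
  ((1 - m / (L * n%:R)) ^+ N * (f x0 - f xstar)
       + L ^+ 2 * n%:R * mu ^+ 2 / (2 * m))%:E)%E.
Proof.
set q := 1 - m / (L * n%:R); set B := L ^+ 2 * n%:R * mu ^+ 2 / (2 * m).
have nR0 : 0 < n%:R :> R by rewrite ltr0n.
have B0 : 0 <= B.
  apply: divr_ge0; last by rewrite mulr_ge0// ltW.
  by rewrite mulr_ge0 ?sqr_ge0// mulr_ge0 ?sqr_ge0.
have q0 : 0 <= q.
  rewrite subr_ge0 ler_pdivrMr ?mulr_gt0// mul1r.
  apply: (le_trans (strongly_convex_le_smooth n_gt0 f_C1 f_sc)).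
  by rewrite ler_peMr ?ler1n// ltW.
have BE : q * B + L * mu ^+ 2 / 2 = B.
  by rewrite /q /B; field; rewrite !gt_eqF.
elim: N => [|N IH].
  rewrite expr0 mul1r; under eq_integral do rewrite /gap /x_ /iterate/=.
  by rewrite integral_prob_cst lee_fin lerDl.
have gapN_fin : (\int[P]_w (gap N w)%:E \is a fin_num)%E.
  rewrite ge0_fin_numE; first exact: le_lt_trans IH (ltry _).
  by apply: integral_ge0 => w _; rewrite lee_fin.
have := expected_gap_step N; move: IH.
rewrite -(fineK gapN_fin); set e := fine _; rewrite lee_fin => IH.
rewrite -EFinM -EFinD -leeBrDr// -EFinB => /le_trans; apply.
rewrite lee_fin.
have -> : e + L * mu ^+ 2 / 2 - m / (L * n%:R) * e = q * e + L * mu ^+ 2 / 2.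
  by rewrite /q; ring.
by rewrite -BE addrA lerD2r exprS -mulrA -mulrDr ler_wpM2l.
Qed.

End ExpectedProgress.

Unset Implicit Arguments.
Set Strict Implicit.

Theorem theorem5p1 (R : realType) (n : nat) (n_gt0 : (0 < n)%N)
  (f : 'rV[R]_n -> R) (L1 m mu : R)
  (L1_gt0 : 0 < L1) (m_gt0 : 0 < m) (mu_ge0 : 0 <= mu)
  (f_C1 : class_C1 L1 f) (f_sc : strongly_convex m f)
  (xstar : 'rV[R]_n) (xstar_min : argmin f = [set xstar])
  (LS LSapprox : 'rV[R]_n -> 'rV[R]_n -> R)
  (LS_exact : exact_line_search f LS)
  (LS_approx : approx_line_search_abs LS mu LSapprox)
  (LS_meas : measurable_oracle LS) (LSapprox_meas : measurable_oracle LSapprox)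
  (d : measure_display) (Omega : measurableType d) (P : probability Omega R)
  (u : nat -> {RV P >-> borelRn R n})
  (u_sphere : forall k w, unit_sphere (u k w))
  (u_unif : forall k, uniform_on_sphere (distribution P (u k)))
  (u_indep : mutually_independent u)
  (x0 : 'rV[R]_n) (N : nat) :
  ('E_P[fun w =>
        (f (random_pursuit LSapprox x0 (fun k => u k w) N) - f xstar)%R]
   <= ((1 - m / (L1 * n%:R)) ^+ N * (f x0 - f xstar)
       + L1 ^+ 2 * n%:R * mu ^+ 2 / (2 * m))%:E)%E.
Proof.
have fmin x : f xstar <= f x.
  by have : argmin f xstar by [rewrite xstar_min]; apply.
rewrite unlock.
exact: (expected_gap_le n_gt0 L1_gt0 m_gt0 f_C1 f_sc fmin LS_exact LS_approx
  LSapprox_meas u_sphere u_unif u_indep).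
Qed.
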